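(* The functions $\sigma_1,\sigma_2$ on $\mathrm{Rat}_2$ given by the explicit formulas in the context are elements of $\left(A_2[\rho^{-1}]_{(0)}\right)^{\mathrm{SL}_2}$, i.e. they are invariant under the conjugation action of $\mathrm{SL}_2$, and they induce an isomorphism $$(\sigma_1,\sigma_2):\mathrm{M}_2\xrightarrow{\ \sim\ }\mathbb{A}^2_{\mathbb{Z}}$$ of schemes over $\mathbb{Z}$.
   Context: Let $A_2=\mathbb{Z}[a_0,a_1,a_2,b_0,b_1,b_2]$, $F_a=a_0X^2+a_1XY+a_2Y^2$, $F_b=b_0X^2+b_1XY+b_2Y^2$, $\rho=\operatorname{Res}(F_a,F_b)$, explicitly $$\rho=a_2^2b_0^2-a_1a_2b_0b_1+a_0a_2b_1^2+a_1^2b_0b_2-2a_0a_2b_0b_2-a_0a_1b_1b_2+a_0^2b_2^2.$$ Put $\mathrm{Rat}_2=\operatorname{Proj}A_2\setminus\{\rho=0\}\subset\mathbb{P}^5_{\mathbb{Z}}$, with coordinate ring $A_2[\rho^{-1}]_{(0)}$ (homogeneous elements of degree $0$). $\mathrm{SL}_2$ acts on $\mathrm{Rat}_2$ by conjugation $\varphi^f=f^{-1}\circ\varphi\circ f$ of rational maps $\varphi=[F_a,F_b]$: for $f=\begin{pmatrix}\alpha&\beta\\ \gamma&\delta\end{pmatrix}$, with $F_a,F_b$ evaluated at $(\alpha X+\beta Y,\gamma X+\delta Y)$, $\varphi^f=[\delta F_a-\beta F_b,\,-\gamma F_a+\alpha F_b]$. $\mathrm{M}_2=\mathrm{Rat}_2/\mathrm{SL}_2$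 is the geometric quotient over $\mathbb{Z}$ (in Mumford's sense); it is the affine scheme $\operatorname{Spec}\left(A_2[\rho^{-1}]_{(0)}\right)^{\mathrm{SL}_2}$. The functions are $$\begin{aligned}\rho\,\sigma_1&=a_1^3b_0-4a_0a_1a_2b_0-6a_2^2b_0^2-a_0a_1^2b_1+4a_0^2a_2b_1+4a_1a_2b_0b_1-2a_0a_2b_1^2+a_2b_1^3-2a_1^2b_0b_2\\&\quad+4a_0a_2b_0b_2-4a_2b_0b_1b_2-a_1b_1^2b_2+2a_0^2b_2^2+4a_1b_0b_2^2,\\ \rho\,\sigma_2&=-a_0^2a_1^2+4a_0^3a_2-2a_1^3b_0+10a_0a_1a_2b_0+12a_2^2b_0^2-4a_0^2a_2b_1-7a_1a_2b_0b_1-a_1^2b_1^2+5a_0a_2b_1^2-2a_2b_1^3\\&\quad+2a_0^2a_1b_2+5a_1^2b_0b_2-4a_0a_2b_0b_2-a_0a_1b_1b_2+10a_2b_0b_1b_2-4a_1b_0b_2^2+2a_0b_1b_2^2-b_1^2b_2^2+4b_0b_2^3.\end{aligned}$$ Over an algebraically closed field, $\sigma_1(\varphi),\sigma_2(\varphi)$ are the first two elementary symmetric functions of the multipliers $\varphi'(P)$ at the three fixed points $P$ of $\varphi$ (counted with multiplicity): $\prod_{P}(T+\varphi'(P))=\sum_{i=0}^3\sigma_i(\varphi)T^{3-i}$. *)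

(* Defs.v *)
From HB Require Import structures.
From mathcomp Require Import all_boot all_algebra fraction generic_quotient ring_quotient.
From mathcomp Require Import mpoly ring.
From mathcomp Require Import boolp.

Set Implicit Arguments.
Unset Strict Implicit.
Unset Printing Implicit Defensive.

Import GRing.Theory.
Local Open Scope ring_scope.
Local Open Scope quotient_scope.

Definition spec (R : comNzRingType) : Type := prime_idealr R.

Definition zariski_open (R : comNzRingType) (U : spec R -> Prop) : Prop :=
  exists E : R -> Prop, forall p : spec R, U p <-> exists2 f, E f & f \notin p.

(* The underlying set of the local ring R_p, as the quotient of R * (R \ p) by
   (a, f) ~ (b, g)  iff  h (a g - b f) = 0 for some h outside p. *)
Section LocalRing.
Variables (R : comNzRingType) (p : spec R).

Definition loc_rel : rel (R * {f : R | f \notin p}) := fun x y =>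
  `[< exists2 h, h \notin p & h * (x.1 * val y.2 - y.1 * val x.2) = 0 >].

Lemma loc_rel_refl : reflexive loc_rel.
Proof.
move=> x; apply/asboolP; exists (val x.2); first exact: (valP x.2).
by rewrite subrr mulr0.
Qed.

Lemma loc_rel_sym : ssrbool.symmetric loc_rel.
Proof.
move=> x y; apply/asboolP/asboolP => -[h hp e]; exists h => //;
  by rewrite -opprB mulrN e oppr0.
Qed.

Lemma loc_rel_trans : transitive loc_rel.
Proof.
move=> y x z /asboolP[h hp e] /asboolP[k kp e']; apply/asboolP.
exists (h * k * val y.2).
  by rewrite !prime_idealrM !negb_or hp kp; exact: (valP y.2).
transitivity (k * val z.2 * (h * (x.1 * val y.2 - y.1 * val x.2))
  + h * val x.2 * (k * (y.1 * val z.2 - z.1 * val y.2))); first by ring.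
by rewrite e e' !mulr0 addr0.
Qed.

Canonical loc_equiv := EquivRel loc_rel loc_rel_refl loc_rel_sym loc_rel_trans.
Canonical loc_equiv_direct := defaultEncModRel loc_rel.

Definition loc : Type := {eq_quot loc_rel}.

Definition frac (a f : R) (fp : f \notin p) : loc :=
  \pi_({eq_quot loc_rel}) (a, exist _ f fp).

Lemma frac_eqP (a f b g : R) (fp : f \notin p) (gp : g \notin p) :
  frac a fp = frac b gp <-> exists2 h, h \notin p & h * (a * g - b * f) = 0.
Proof.
by split=> [/eqmodP/asboolP | e]; [| apply/eqmodP/asboolP].
Qed.
End LocalRing.

(* The structure sheaf: functions with values in the local rings that are
   locally given by a single fraction. *)
Definition regular (R : comNzRingType) (U : spec R -> Prop)
    (s : forall p, U p -> loc p) : Prop :=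
  forall p, U p -> exists V : spec R -> Prop,
    [/\ zariski_open V, V p, forall q, V q -> U q &
        exists a f : R, forall q (Vq : V q) (Uq : U q),
          exists fq : f \notin q, s q Uq = frac a fq].

Definition sections (R : comNzRingType) (U : spec R -> Prop) : Type :=
  {s : forall p, U p -> loc p | regular s}.

Section SpecMorphism.
Variables (R S : comNzRingType) (phi : {rmorphism R -> S}).

Section Preimage.
Variable q : spec S.

Definition preideal : R -> bool := fun x => phi x \in q.

Lemma in_preideal x : (x \in preideal) = (phi x \in q).
Proof. by []. Qed.

Lemma preideal_idealr : idealr_closed preideal.
Proof.
split; rewrite ?in_preideal ?rmorph0 ?rmorph1 ?idealr1 ?rpred0 //.
move=> a x y; rewrite !in_preideal rmorphD rmorphM => xq yq.
by rewrite rpredD // idealMr.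
Qed.

Lemma preideal_prime : prime_idealr_closed preideal.
Proof. by move=> x y; rewrite !in_preideal rmorphM prime_idealrM. Qed.

HB.instance Definition _ := isIdealr.Build R preideal preideal_idealr.
HB.instance Definition _ := isPrimeIdealrClosed.Build R preideal preideal_prime.

Definition spec_map : spec R := preideal : prime_idealr R.

(* a / f |-> phi a / phi f *)
Definition loc_map (x : loc spec_map) : loc q :=
  frac (phi (repr x).1) (valP (repr x).2 : phi (val (repr x).2) \notin q).

Lemma loc_map_frac (a f : R) (fp : f \notin spec_map) :
  loc_map (frac a fp) = frac (phi a) (fp : phi f \notin q).
Proof.
rewrite /loc_map; set x := repr _.
have : frac x.1 (valP x.2) = frac a fp.
  rewrite -[RHS]reprK -/x /frac; congr (\pi _).
  by case: (x) => u [g gp] /=; congr (_, exist _ _ _); apply: bool_irrelevance.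
case/frac_eqP=> h hp e; apply/frac_eqP; exists (phi h); first exact: hp.
by rewrite -!rmorphM -rmorphB -rmorphM e rmorph0.
Qed.
End Preimage.

Lemma spec_map_continuous (U : spec R -> Prop) :
  zariski_open U -> zariski_open (fun q => U (spec_map q)).
Proof.
move=> [E UE]; exists (fun g => exists2 f, E f & g = phi f) => q.
split=> [/UE[f Ef fq]|[_ [f Ef ->] fq]]; first by exists (phi f) => //; exists f.
by apply/UE; exists f.
Qed.

Definition pullback_fun (U : spec R -> Prop) (s : forall p, U p -> loc p)
    (q : spec S) (Uq : U (spec_map q)) : loc q := loc_map (s _ Uq).

Lemma pullback_regular (U : spec R -> Prop) (s : forall p, U p -> loc p) :
  regular s -> regular (pullback_fun s).
Proof.
move=> rs q Uq; have [V [Vo Vq VU [a [f sE]]]] := rs _ Uq.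
exists (fun q' => V (spec_map q')); split=> //.
- exact: spec_map_continuous.
- by move=> q'; apply: VU.
exists (phi a), (phi f) => q' Vq' Uq'; have [fq' e] := sE _ Vq' Uq'.
by exists fq'; rewrite /pullback_fun e loc_map_frac.
Qed.

Definition pullback (U : spec R -> Prop) (s : sections U) :
    sections (fun q => U (spec_map q)) :=
  exist _ (pullback_fun (sval s)) (pullback_regular (svalP s)).

(* The morphism Spec S -> Spec R induced by phi is an isomorphism of schemes:
   a homeomorphism with an isomorphism of structure sheaves.  The ring structure
   on sections is pointwise and pullback is a ring morphism, as phi is one; so
   bijectivity is what remains to be required. *)
Definition spec_isomorphism : Prop :=
  [/\ bijective spec_map,
      forall U : spec R -> Prop,
        zariski_open U <-> zariski_open (fun q => U (spec_map q)) &
      forall U : spec R -> Prop, zariski_open U -> bijective (@pullback U)].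
End SpecMorphism.

(* The coordinates of [F_a, F_b] are listed as (a0, a1, a2, b0, b1, b2). *)
Section Conjugation.
Variable C : comNzRingType.

Definition conj_map (g : 'M[C]_2) (v : 6.-tuple C) : 6.-tuple C :=
  let: (al, be) := (g 0 0, g 0 1) in
  let: (ga, de) := (g 1 0, g 1 1) in
  (* coefficients of c0 X^2 + c1 X Y + c2 Y^2 at (al X + be Y, ga X + de Y) *)
  let s0 c0 c1 c2 := c0 * al ^+ 2 + c1 * al * ga + c2 * ga ^+ 2 in
  let s1 c0 c1 c2 := 2 * c0 * al * be + c1 * (al * de + be * ga)
                     + 2 * c2 * ga * de in
  let s2 c0 c1 c2 := c0 * be ^+ 2 + c1 * be * de + c2 * de ^+ 2 in
  let L s := s v`_0 v`_1 v`_2 in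
  let M s := s v`_3 v`_4 v`_5 in
  [tuple de * L s0 - be * M s0; de * L s1 - be * M s1; de * L s2 - be * M s2;
         - ga * L s0 + al * M s0; - ga * L s1 + al * M s1; - ga * L s2 + al * M s2].

Definition form_a (v : 6.-tuple C) (X Y : C) : C :=
  v`_0 * X ^+ 2 + v`_1 * X * Y + v`_2 * Y ^+ 2.
Definition form_b (v : 6.-tuple C) (X Y : C) : C :=
  v`_3 * X ^+ 2 + v`_4 * X * Y + v`_5 * Y ^+ 2.

Lemma conj_mapE (g : 'M[C]_2) (v : 6.-tuple C) (X Y : C) :
  let X' := g 0 0 * X + g 0 1 * Y in
  let Y' := g 1 0 * X + g 1 1 * Y in
  form_a (conj_map g v) X Y = g 1 1 * form_a v X' Y' - g 0 1 * form_b v X' Y' /\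
  form_b (conj_map g v) X Y = - g 1 0 * form_a v X' Y' + g 0 0 * form_b v X' Y'.
Proof. by rewrite /form_a /form_b /conj_map /=; split; ring. Qed.
End Conjugation.


Section ExplicitFormulas.
Local Notation a0 := ('X_(inord 0) : {mpoly int[6]}).
Local Notation a1 := ('X_(inord 1) : {mpoly int[6]}).
Local Notation a2 := ('X_(inord 2) : {mpoly int[6]}).
Local Notation b0 := ('X_(inord 3) : {mpoly int[6]}).
Local Notation b1 := ('X_(inord 4) : {mpoly int[6]}).
Local Notation b2 := ('X_(inord 5) : {mpoly int[6]}).

Definition rho : {mpoly int[6]} :=
  a2 ^+ 2 * b0 ^+ 2 - a1 * a2 * b0 * b1 + a0 * a2 * b1 ^+ 2 + a1 ^+ 2 * b0 * b2
  - 2 * a0 * a2 * b0 * b2 - a0 * a1 * b1 * b2 + a0 ^+ 2 * b2 ^+ 2.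

Definition rho_sigma1 : {mpoly int[6]} :=
  a1 ^+ 3 * b0 - 4 * a0 * a1 * a2 * b0 - 6 * a2 ^+ 2 * b0 ^+ 2
  - a0 * a1 ^+ 2 * b1 + 4 * a0 ^+ 2 * a2 * b1 + 4 * a1 * a2 * b0 * b1
  - 2 * a0 * a2 * b1 ^+ 2 + a2 * b1 ^+ 3 - 2 * a1 ^+ 2 * b0 * b2
  + 4 * a0 * a2 * b0 * b2 - 4 * a2 * b0 * b1 * b2 - a1 * b1 ^+ 2 * b2
  + 2 * a0 ^+ 2 * b2 ^+ 2 + 4 * a1 * b0 * b2 ^+ 2.

Definition rho_sigma2 : {mpoly int[6]} :=
  - a0 ^+ 2 * a1 ^+ 2 + 4 * a0 ^+ 3 * a2 - 2 * a1 ^+ 3 * b0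
  + 10 * a0 * a1 * a2 * b0 + 12 * a2 ^+ 2 * b0 ^+ 2 - 4 * a0 ^+ 2 * a2 * b1
  - 7 * a1 * a2 * b0 * b1 - a1 ^+ 2 * b1 ^+ 2 + 5 * a0 * a2 * b1 ^+ 2
  - 2 * a2 * b1 ^+ 3 + 2 * a0 ^+ 2 * a1 * b2 + 5 * a1 ^+ 2 * b0 * b2
  - 4 * a0 * a2 * b0 * b2 - a0 * a1 * b1 * b2 + 10 * a2 * b0 * b1 * b2
  - 4 * a1 * b0 * b2 ^+ 2 + 2 * a0 * b1 * b2 ^+ 2 - b1 ^+ 2 * b2 ^+ 2
  + 4 * b0 * b2 ^+ 3.
End ExplicitFormulas.

Definition eval_at (C : comNzRingType) (v : 6.-tuple C) (N : {mpoly int[6]}) : C :=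
  mmap (intr : int -> C) (tnth v) N.

(* For N homogeneous of degree 4 k, the function N / rho^k on Rat_2 is invariant
   under the group scheme SL_2: it takes the same value at v and at its
   conjugate by g for every commutative ring C, every C-point v of
   {rho invertible} and every g in SL_2(C). *)
Definition SL2_invariant (N : {mpoly int[6]}) (k : nat) : Prop :=
  forall (C : comUnitRingType) (g : 'M[C]_2) (v : 6.-tuple C),
    \det g = 1 -> eval_at v rho \is a GRing.unit ->
    eval_at (conj_map g v) N / eval_at (conj_map g v) rho ^+ k
    = eval_at v N / eval_at v rho ^+ k.

(* A_2[1/rho]_(0) is taken inside Frac(A_2): its elements are the N / rho^k with
   N homogeneous of degree 4 k, as rho is homogeneous of degree 4. *)
Definition M2_pred : {pred {fraction {mpoly int[6]}}} := fun x =>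
  `[< exists (N : {mpoly int[6]}) (k : nat),
      [/\ N \is (4 * k)%N.-homog, x = tofrac N / tofrac rho ^+ k & SL2_invariant N k] >].

Lemma rho_homog : rho \is 4.-homog.
Proof.
have X k : ('X_(inord k) : {mpoly int[6]}) \is 1.-homog by rewrite dhomogX /= mdeg1.
have two : (2 : {mpoly int[6]}) \is 0.-homog.
  by rewrite -[2]/(1 + 1); apply: dhomogD; apply: dhomog1.
have hD (p q : {mpoly int[6]}) : p \is 4.-homog -> q \is 4.-homog ->
  p + q \is 4.-homog by exact: dhomogD.
have hB (p q : {mpoly int[6]}) : p \is 4.-homog -> q \is 4.-homog ->
  p - q \is 4.-homog by move=> ? ?; apply: hD; rewrite ?dhomogN.
have hM d e (p q : {mpoly int[6]}) : p \is d.-homog -> q \is e.-homog ->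
  p * q \is (d + e)%N.-homog by exact: dhomogM.
have hX d k (p : {mpoly int[6]}) : p \is d.-homog ->
  p ^+ k \is (d * k)%N.-homog by exact: dhomogMn.
rewrite /rho.
apply: (hD _ _ _ (hM _ _ _ _ (hX _ 2%N _ (X 0%N)) (hX _ 2%N _ (X 5%N)))).
apply: (hB _ _ _ (hM _ _ _ _ (hM _ _ _ _ (hM _ _ _ _ (X 0%N) (X 1%N)) (X 4%N)) (X 5%N))).
apply: (hB _ _ _ (hM _ _ _ _ (hM _ _ _ _ (hM _ _ _ _ (hM _ _ _ _ two (X 0%N)) (X 2%N)) (X 3%N)) (X 5%N))).
apply: (hD _ _ _ (hM _ _ _ _ (hM _ _ _ _ (hX _ 2%N _ (X 1%N)) (X 3%N)) (X 5%N))).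
apply: (hD _ _ _ (hM _ _ _ _ (hM _ _ _ _ (X 0%N) (X 2%N)) (hX _ 2%N _ (X 4%N)))).
apply: (hB _ _ _ (hM _ _ _ _ (hM _ _ _ _ (hM _ _ _ _ (X 1%N) (X 2%N)) (X 3%N)) (X 4%N))).
exact: (hM _ _ _ _ (hX _ 2%N _ (X 2%N)) (hX _ 2%N _ (X 3%N))).
Qed.

Lemma eval_at_rho (C : comNzRingType) (v : 6.-tuple C) :
  eval_at v rho =
    v`_2 ^+ 2 * v`_3 ^+ 2 - v`_1 * v`_2 * v`_3 * v`_4 + v`_0 * v`_2 * v`_4 ^+ 2
    + v`_1 ^+ 2 * v`_3 * v`_5 - 2 * v`_0 * v`_2 * v`_3 * v`_5
    - v`_0 * v`_1 * v`_4 * v`_5 + v`_0 ^+ 2 * v`_5 ^+ 2.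
Proof.
have X k : (k < 6)%N -> eval_at v 'X_(inord k) = v`_k.
  by move=> k6; rewrite /eval_at mmapX mmap1U (tnth_nth 0) inordK.
pose ev : {rmorphism {mpoly int[6]} -> C} := mmap (intr : int -> C) (tnth v).
rewrite -[LHS]/(ev rho) /rho.
rewrite !(rmorphD, rmorphB, rmorphN, rmorphM, rmorphXn) ?rmorph1.
by rewrite -![ev 'X_(_)]/(eval_at v _) !X.
Qed.

Lemma rho_neq0 : rho != 0.
Proof.
apply/negP => /eqP e.
have := eval_at_rho [tuple 1; 0; 0; 0; 0; 1 : int].
by rewrite e /eval_at mmap0.
Qed.

Lemma eval_at_rho_conj (C : comNzRingType) (g : 'M[C]_2) (v : 6.-tuple C) :
  \det g = 1 -> eval_at (conj_map g v) rho = eval_at v rho.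
Proof.
have -> : \det g = g 0 0 * g 1 1 - g 0 1 * g 1 0.
  rewrite (expand_det_row _ 0) !big_ord_recl big_ord0 /cofactor !det_mx11 !mxE.
  have e1 : lift ord0 ord0 = 1 :> 'I_2 by apply/val_inj.
  have e0 : lift 1 0 = 0 :> 'I_2 by apply/val_inj.
  by rewrite !(e1, e0) /= expr0 expr1 addr0 mul1r mulN1r mulrN.
move=> dg; transitivity ((g 0 0 * g 1 1 - g 0 1 * g 1 0) ^+ 6 * eval_at v rho).
  by rewrite !eval_at_rho /conj_map /=; ring.
by rewrite dg expr1n mul1r.
Qed.

(* Invariance depends only on the element N / rho^k of Frac(A_2). *)
Lemma SL2_invariant_frac (N N' : {mpoly int[6]}) (k k' : nat) :
  tofrac N / tofrac rho ^+ k = tofrac N' / tofrac rho ^+ k' ->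
  SL2_invariant N k -> SL2_invariant N' k'.
Proof.
have rz j : tofrac rho ^+ j != 0 by rewrite expf_neq0 // tofrac_eq0 rho_neq0.
move=> /eqP; rewrite eqr_div // -!tofracXn -!tofracM tofrac_eq => /eqP e inv C g v dg vu.
have ev (w : 6.-tuple C) : eval_at w rho \is a GRing.unit ->
    eval_at w N' / eval_at w rho ^+ k' = eval_at w N / eval_at w rho ^+ k.
  move=> wu; apply: (canLR (mulrK _)); first by rewrite unitrX.
  rewrite mulrAC; apply: (canRL (mulrK _)); first by rewrite unitrX.
  pose f : {rmorphism {mpoly int[6]} -> C} := mmap (intr : int -> C) (tnth w).
  by have := congr1 f e; rewrite !(rmorphM, rmorphXn) => <-.
by rewrite !ev ?eval_at_rho_conj // -(inv C g v dg vu) eval_at_rho_conj.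
Qed.

Lemma M2_pred_subring : subring_closed M2_pred.
Proof.
have rz j : tofrac rho ^+ j != 0 by rewrite expf_neq0 // tofrac_eq0 rho_neq0.
have evM (C : comNzRingType) (v : 6.-tuple C) p q :
  eval_at v (p * q) = eval_at v p * eval_at v q by exact: rmorphM.
have evB (C : comNzRingType) (v : 6.-tuple C) p q :
  eval_at v (p - q) = eval_at v p - eval_at v q by exact: rmorphB.
have evX (C : comNzRingType) (v : 6.-tuple C) p k :
  eval_at v (p ^+ k) = eval_at v p ^+ k by exact: rmorphXn.
split.
- apply/asboolP; exists 1, 0%N; split; first by rewrite muln0 dhomog1.
    by rewrite expr0 divr1 tofrac1.
  by move=> C g v _ _; rewrite /eval_at !rmorph1 !expr0.
- move=> x y /asboolP[N [k [hN xE iN]]] /asboolP[M [l [hM yE iM]]].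
  apply/asboolP; exists (N * rho ^+ l - M * rho ^+ k), (k + l)%N; split.
  + apply: rpredB; rewrite mulnDr; first exact: dhomogM hN (dhomogMn _ rho_homog).
    by rewrite addnC; exact: dhomogM hM (dhomogMn _ rho_homog).
  + by rewrite xE yE -mulNr addf_div // tofracB !tofracM !tofracXn exprD mulNr.
  move=> C g v dg vu.
  have key (w : 6.-tuple C) : eval_at w rho \is a GRing.unit ->
      eval_at w (N * rho ^+ l - M * rho ^+ k) / eval_at w rho ^+ (k + l) =
      eval_at w N / eval_at w rho ^+ k - eval_at w M / eval_at w rho ^+ l.
    move=> wu; apply: (canLR (mulrK _)); first by rewrite unitrX.
    rewrite evB !evM !evX exprD mulrBl mulrA divrK ?unitrX //.
    by rewrite [X in _ - _ / _ * X]mulrC mulrA divrK ?unitrX.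
  by rewrite !key ?eval_at_rho_conj // -(iN C g v dg vu) -(iM C g v dg vu) eval_at_rho_conj.
- move=> x y /asboolP[N [k [hN xE iN]]] /asboolP[M [l [hM yE iM]]].
  apply/asboolP; exists (N * M), (k + l)%N; split.
  + by rewrite mulnDr; exact: dhomogM.
  + by rewrite xE yE mulf_div tofracM exprD.
  move=> C g v dg vu.
  have key (w : 6.-tuple C) : eval_at w rho \is a GRing.unit ->
      eval_at w (N * M) / eval_at w rho ^+ (k + l) =
      (eval_at w N / eval_at w rho ^+ k) * (eval_at w M / eval_at w rho ^+ l).
    move=> wu; rewrite evM exprD invrM ?unitrX //.
    by rewrite [RHS]mulrACA; congr (_ * _); rewrite mulrC.
  by rewrite !key ?eval_at_rho_conj // -(iN C g v dg vu) -(iM C g v dg vu) eval_at_rho_conj.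
Qed.

HB.instance Definition _ :=
  GRing.isSubringClosed.Build {fraction {mpoly int[6]}} M2_pred M2_pred_subring.

(* (A_2[1/rho]_(0))^(SL_2) *)
Record M2_ring := M2Ring { M2_val :> {fraction {mpoly int[6]}}; _ : M2_val \in M2_pred }.
HB.instance Definition _ := [isSub for M2_val].
HB.instance Definition _ := [Choice of M2_ring by <:].
HB.instance Definition _ := [SubChoice_isSubComNzRing of M2_ring by <:].

Definition sigma1 : {fraction {mpoly int[6]}} := tofrac rho_sigma1 / tofrac rho.
Definition sigma2 : {fraction {mpoly int[6]}} := tofrac rho_sigma2 / tofrac rho.

(* With M_2 = Spec M2_ring and A^2_Z = Spec Z[T_1, T_2], the morphism
   (s1, s2) : M_2 -> A^2_Z is the spec_map of the ring morphism sending T_1 to s1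
   and T_2 to s2. *)
Definition plane_comorphism (s1 s2 : M2_ring) : {rmorphism {mpoly int[2]} -> M2_ring} :=
  mmap (intr : int -> M2_ring) (fun i : 'I_2 => if i == 0 then s1 else s2).

(* Main.v *)
From HB Require Import structures.
Require Import Defs.
From mathcomp Require Import all_boot all_algebra mpoly.
From mathcomp Require Import fraction generic_quotient ring_quotient.
From mathcomp Require Import boolp ring algC.

(** A bijective ring morphism induces an isomorphism of spectra
    ([spec_isomorphism_of_bij]), so the point is that every invariant function is
    a unique polynomial with integer coefficients in sigma1 and sigma2.

    Invariants are compared through their values over the field algC of algebraic
    numbers: a polynomial with integer coefficients is zero when it vanishes at all
    points over algC ([mpoly_eq0_algC]). A general map has two distinct fixed points;
    moving them to 0 and infinity makes it conjugate to a Milnor form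
    [X^2 + m1 X Y, m2 X Y + Y^2] of resultant 1 - m1 m2, where m1 and m2 are the
    multipliers there ([milnor_form]). The third multiplier m3 satisfies
    m1 m2 m3 = m1 + m2 + m3 - 2, and conversely every point of the plane outside the
    line 2 sigma1 - sigma2 = 3 is the image of a Milnor form. Hence sigma1 and sigma2
    are algebraically independent ([sigma_inj]).

    Let f be invariant. Its value at a Milnor form is a polynomial in m1 and m2
    divided by (1 - m1 m2)^k, and it is symmetric in m1, m2, m3, since any two of the
    three fixed points can be moved to 0 and infinity. The product of the three
    resultants 1 - mi mj is L = 2 sigma1 - sigma2 - 3, so f L^k is a polynomial in
    m1, m2, m3 with integer coefficients. By the cubic equation of the multipliers
    this polynomial is a combination of the m1^i m2^j with i <= 2 and j <= 1, with
    coefficients in Z[sigma1, sigma2], and by symmetry only the coefficient of 1 is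
    nonzero. So f L^k = P(sigma1, sigma2) with P integral ([invariant_on_milnor]).

    The denominator L is spurious. The maps [X^2 + c X Y + Y^2, X Y] have resultant 1
    and a multiple fixed point, and their images fill the line L = 0. As f is defined at
    these maps, P vanishes on this line when k > 0; then L divides P, and k can be
    lowered to 0 ([sigma_surj]). *)

Set Implicit Arguments.
Unset Strict Implicit.
Unset Printing Implicit Defensive.

Import GRing.Theory.
Local Open Scope ring_scope.

(** * Isomorphisms of spectra *)

(** A point of the spectrum is determined by the elements of its prime ideal: the
    remaining fields of the structure are proofs. *)
Lemma spec_ext (R : comNzRingType) (p q : spec R) : p =i q -> p = q.
Proof.
case: p q => S [[m1] [m2] [m3] [m4]] [S' [[n1] [n2] [n3] [n4]]] e.
have eS : S = S' by apply/funext => x; exact: (e x).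
case: S' / eS n1 n2 n3 n4 {e} => n1 n2 n3 n4.
by congr (PrimeIdealr.Pack (PrimeIdealr.Class _ _ _ _)); congr (_ _);
  apply: Prop_irrelevance.
Qed.

Lemma frac_surj (A : comNzRingType) (p : spec A) (x : loc p) :
  exists a f (fp : f \notin p), x = Defs.frac a fp.
Proof. by rewrite -[x]reprK; case: (repr x) => a [f fp]; exists a, f, fp. Qed.

Section SpecIsoOfBijection.
Variables (R S : comNzRingType) (phi : {rmorphism R -> S}).
Variables (psi : {rmorphism S -> R}).
Hypotheses (phiK : cancel phi psi) (psiK : cancel psi phi).

Let spec_mapK (q : spec S) : spec_map psi (spec_map phi q) = q.
Proof. by apply: spec_ext => x; rewrite 2!in_preideal psiK. Qed.

Let spec_mapVK (p : spec R) : spec_map phi (spec_map psi p) = p.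
Proof. by apply: spec_ext => x; rewrite 2!in_preideal phiK. Qed.

Lemma loc_map_inj (q : spec S) : injective (@loc_map R S phi q).
Proof.
move=> x y; have [a [f [fp ->]]] := frac_surj x.
have [b [g [gp ->]]] := frac_surj y.
rewrite !loc_map_frac => /frac_eqP[h hq e]; apply/frac_eqP.
exists (psi h); first by rewrite in_preideal psiK.
by apply: (can_inj phiK); rewrite !(rmorphM, rmorphB) rmorph0 /= psiK.
Qed.

Lemma pullback_bij (U : spec R -> Prop) : bijective (@pullback R S phi U).
Proof.
have sec_ext (A : comNzRingType) (V : spec A -> Prop) (s t : sections V) :
    (forall p Vp, sval s p Vp = sval t p Vp) -> s = t.
  case: s t => s rs [t rt] /= st; apply: eq_exist.
  by apply/functional_extensionality_dep => p;
    apply/functional_extensionality_dep => Vp.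
(* The inverse of the pullback sends t to the section whose value at p is the
   image of t (spec_map psi p) under the map of local rings induced by psi. *)
pose T := sections (fun q => U (spec_map phi q)).
have U' p : U p -> U (spec_map phi (spec_map psi p)) by rewrite spec_mapVK.
pose inv_fun (t : T) p (Up : U p) := loc_map (sval t (spec_map psi p) (U' p Up)).
have inv_reg (t : T) : regular (inv_fun t).
  move=> p Up; have [V [Vo Vp VU [a [f sE]]]] := svalP t _ (U' p Up).
  exists (fun p' => V (spec_map psi p')); split=> //.
  - exact: spec_map_continuous.
  - by move=> p' /VU; rewrite spec_mapVK.
  exists (psi a), (psi f) => p' Vp' Up'; have [fp' e] := sE _ Vp' (U' p' Up').
  by exists fp'; rewrite /inv_fun e loc_map_frac.
have canT (t : T) : @pullback R S phi U (exist _ _ (inv_reg t)) = t.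
  apply: sec_ext => q Uq /=; rewrite /pullback_fun /inv_fun.
  (* The points spec_map psi (spec_map phi q) and q are only propositionally
     equal, so the values of t there are compared through fractions. *)
  have transport q' (e : q' = q) Uq' a f (fp : f \notin q') (fq : f \notin q) :
      sval t q' Uq' = Defs.frac a fp -> sval t q Uq = Defs.frac a fq.
    move: Uq' fp; rewrite e => Uq' fp E.
    by rewrite (Prop_irrelevance Uq Uq') E; congr Defs.frac; apply: bool_irrelevance.
  move: (U' _ Uq) => Uq'.
  have [a [f [fp E]]] := frac_surj (sval t _ Uq').
  have fq : f \notin q by have := fp; rewrite spec_mapK.
  rewrite (transport _ (spec_mapK q) Uq' a f fp fq E) E !loc_map_frac.
  by apply/frac_eqP; exists 1; rewrite ?idealr1 // !psiK mul1r subrr.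
exists (fun t => exist _ _ (inv_reg t)) => // s.
apply: sec_ext => p; rewrite -[p]spec_mapVK => Up.
have := congr1 (fun u : T => sval u (spec_map psi p) Up) (canT (@pullback R S phi U s)).
exact: loc_map_inj.
Qed.

Lemma spec_isomorphism_of_can : spec_isomorphism phi.
Proof.
split.
- by exists (spec_map psi).
- move=> U; split; first exact: spec_map_continuous.
  move=> /(spec_map_continuous psi); congr zariski_open.
  by apply/funext => p /=; rewrite spec_mapVK.
- by move=> U _; exact: pullback_bij.
Qed.
End SpecIsoOfBijection.

Lemma spec_isomorphism_of_bij (R S : comNzRingType) (phi : {rmorphism R -> S}) :
  injective phi -> (forall y, exists x, phi x = y) -> spec_isomorphism phi.
Proof.
move=> phi_inj /choice[psi psiK].
have phiK : cancel phi psi by move=> x; apply: phi_inj.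
pose zM := GRing.isZmodMorphism.Build S R psi (can2_zmod_morphism phiK psiK).
pose mM := GRing.isMonoidMorphism.Build S R psi (can2_monoid_morphism phiK psiK).
pose Psi : {rmorphism S -> R} := HB.pack psi zM mM.
exact: (@spec_isomorphism_of_can R S phi Psi).
Qed.

(** * Polynomials with integer coefficients and their values *)

Lemma mpoly_ring_ind n (K : {mpoly int[n]} -> Prop) :
  (forall c : int, K c%:~R) -> (forall i, K 'X_i) ->
  (forall p q, K p -> K q -> K (p + q)) ->
  (forall p q, K p -> K q -> K (p * q)) -> forall p, K p.
Proof.
move=> KC KX KD KM; elim/mpolyind => [|c m p _ _ Kp]; first exact: KC 0.
apply: (KD) => //; rewrite -mul_mpolyC mpolyXE_id; apply: (KM).
  by rewrite -[c in c%:MP]intz rmorph_int.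
have K1 : K 1 by exact: (KC 1).
refine (big_ind K K1 _ _) => [p' q'|i _]; first exact: KM.
elim: (m i) => [|k IH]; first by rewrite expr0.
by rewrite exprS; apply: (KM).
Qed.

Lemma rmorph_mpoly_ext n (C : nzRingType) (f g : {rmorphism {mpoly int[n]} -> C}) :
  (forall i, f 'X_i = g 'X_i) -> f =1 g.
Proof.
move=> fg; apply: mpoly_ring_ind => // [c|p q ep eq|p q ep eq].
- by rewrite !rmorph_int.
- by rewrite !rmorphD ep eq.
- by rewrite !rmorphM ep eq.
Qed.

Lemma ord2P (i : 'I_2) : i = 0 \/ i = 1.
Proof. by case: i => -[|[|//]] lt2; [left | right]; apply/val_inj. Qed.

Lemma poly_eq0_algC (p : {poly algC}) : (forall x, p.[x] = 0) -> p = 0.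
Proof.
move=> p0; apply/eqP; apply: contraT => pn0.
have := @max_poly_roots _ p [seq i%:R | i <- iota 0 (size p)] pn0.
rewrite size_map size_iota ltnn; apply.
  by apply/allP => x _; apply/rootP.
by rewrite map_inj_uniq ?iota_uniq // => i j /eqP; rewrite Num.Theory.eqr_nat => /eqP.
Qed.

(** The point of affine (n+1)-space with first coordinates f and last coordinate
    x, the value at i. *)
Definition extend_last n (i : 'I_n.+1) (T : Type) (f : 'I_n -> T) (x : T) : T :=
  if unlift ord_max i is Some j then f j else x.

Lemma muniXE n (i : 'I_n.+1) :
  muni ('X_i : {mpoly int[n.+1]}) = extend_last i (fun j => ('X_j)%:P) 'X.
Proof.
rewrite /muni /= mmapX mmap1U; case: splitP => j /= ij; rewrite /extend_last.
  case: unliftP => [k ik|im]; last first.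
    by move: ij (ltn_ord j); rewrite im /= => <-; rewrite ltnn.
  by congr ('X__)%:P; apply/val_inj; rewrite /= -ij ik lift_max.
case: unliftP => [k ik|//]; move: ij; rewrite ik lift_max ord1 addn0 => e.
by have := ltn_ord k; rewrite e ltnn.
Qed.

(** Density: a polynomial with integer coefficients that vanishes at all points
    over algC is zero. The proof is by induction on the number of variables,
    seeing p as a polynomial in its last variable. *)
Lemma mpoly_eq0_algC n (p : {mpoly int[n]}) :
  (forall v : 'I_n -> algC, mmap intr v p = 0) -> p = 0.
Proof.
elim: n p => [|n IHn] p p0.
  have := p0 (fun _ => 0); rewrite [p]nvar0_mpolyC mmapC => /eqP.
  by rewrite intr_eq0 => /eqP ->.
have evE (v : 'I_n -> algC) (x : algC) :
    mmap intr (fun i => extend_last i v x) p = (map_poly (mmap intr v) (muni p)).[x].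
  have := @rmorph_mpoly_ext _ _ (mmap intr (fun i => extend_last i v x))
    (horner_eval x \o map_poly (mmap intr v) \o @muni n int) _ p.
  rewrite /= /horner_eval; apply => i.
  rewrite /= mmapX mmap1U /horner_eval muniXE /extend_last.
  case: unliftP => [j _|_]; last by rewrite map_polyX hornerX.
  by rewrite map_polyC hornerC /= mmapX mmap1U.
have u0 : muni p = 0.
  apply/polyP => k; rewrite coef0; apply: IHn => v.
  rewrite -(coef_map (mmap intr v)) [map_poly _ _]poly_eq0_algC ?coef0 // => x.
  by rewrite -evE p0.
(* muni is injective: substituting the last variable recovers p. *)
have := @rmorph_mpoly_ext _ _ idfun
  (horner_eval 'X_ord_max
    \o map_poly (mmap intr (fun i => 'X_(lift ord_max i))) \o @muni n int) _ p.
rewrite /= u0 map_poly0 /horner_eval horner0; apply=> i.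
rewrite /= /horner_eval muniXE /extend_last.
case: unliftP => [j ->|->]; last by rewrite map_polyX hornerX.
by rewrite map_polyC hornerC /= mmapX mmap1U.
Qed.

(** * Invariance and homogeneity of the numerators of sigma1 and sigma2 *)

Lemma det_mx2 (C : comNzRingType) (g : 'M[C]_2) :
  \det g = g 0 0 * g 1 1 - g 0 1 * g 1 0.
Proof.
rewrite (expand_det_row _ 0) !big_ord_recl big_ord0 /cofactor !det_mx11 !mxE.
have e1 : lift ord0 ord0 = 1 :> 'I_2 by apply/val_inj.
have e0 : lift 1 0 = 0 :> 'I_2 by apply/val_inj.
by rewrite !(e1, e0) /= expr0 expr1 addr0 mul1r mulN1r mulrN.
Qed.

Section EvalAt.
Variables (C : comNzRingType) (v : 6.-tuple C).

Lemma eval_atD : {morph eval_at v : p q / p + q}.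
Proof. exact: rmorphD. Qed.

Lemma eval_atB : {morph eval_at v : p q / p - q}.
Proof. exact: rmorphB. Qed.

Lemma eval_atM : {morph eval_at v : p q / p * q}.
Proof. exact: rmorphM. Qed.

Lemma eval_atX k : {morph eval_at v : p / p ^+ k}.
Proof. exact: rmorphXn. Qed.

Lemma eval_at_var k : (k < 6)%N -> eval_at v 'X_(inord k) = v`_k.
Proof. by move=> k6; rewrite /eval_at mmapX mmap1U (tnth_nth 0) inordK. Qed.

Lemma eval_at_rho_sigma1 : eval_at v rho_sigma1 =
  let: (a0, a1, a2) := (v`_0, v`_1, v`_2) in
  let: (b0, b1, b2) := (v`_3, v`_4, v`_5) in
  a1 ^+ 3 * b0 - 4 * a0 * a1 * a2 * b0 - 6 * a2 ^+ 2 * b0 ^+ 2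
  - a0 * a1 ^+ 2 * b1 + 4 * a0 ^+ 2 * a2 * b1 + 4 * a1 * a2 * b0 * b1
  - 2 * a0 * a2 * b1 ^+ 2 + a2 * b1 ^+ 3 - 2 * a1 ^+ 2 * b0 * b2
  + 4 * a0 * a2 * b0 * b2 - 4 * a2 * b0 * b1 * b2 - a1 * b1 ^+ 2 * b2
  + 2 * a0 ^+ 2 * b2 ^+ 2 + 4 * a1 * b0 * b2 ^+ 2.
Proof.
pose ev : {rmorphism {mpoly int[6]} -> C} := mmap (intr : int -> C) (tnth v).
rewrite -[LHS]/(ev _) /rho_sigma1.
rewrite !(rmorphD, rmorphB, rmorphN, rmorphM, rmorphXn) ?rmorph1.
by rewrite -![ev 'X_(_)]/(eval_at v _) !eval_at_var.
Qed.

Lemma eval_at_rho_sigma2 : eval_at v rho_sigma2 =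
  let: (a0, a1, a2) := (v`_0, v`_1, v`_2) in
  let: (b0, b1, b2) := (v`_3, v`_4, v`_5) in
  - a0 ^+ 2 * a1 ^+ 2 + 4 * a0 ^+ 3 * a2 - 2 * a1 ^+ 3 * b0
  + 10 * a0 * a1 * a2 * b0 + 12 * a2 ^+ 2 * b0 ^+ 2 - 4 * a0 ^+ 2 * a2 * b1
  - 7 * a1 * a2 * b0 * b1 - a1 ^+ 2 * b1 ^+ 2 + 5 * a0 * a2 * b1 ^+ 2
  - 2 * a2 * b1 ^+ 3 + 2 * a0 ^+ 2 * a1 * b2 + 5 * a1 ^+ 2 * b0 * b2
  - 4 * a0 * a2 * b0 * b2 - a0 * a1 * b1 * b2 + 10 * a2 * b0 * b1 * b2
  - 4 * a1 * b0 * b2 ^+ 2 + 2 * a0 * b1 * b2 ^+ 2 - b1 ^+ 2 * b2 ^+ 2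
  + 4 * b0 * b2 ^+ 3.
Proof.
pose ev : {rmorphism {mpoly int[6]} -> C} := mmap (intr : int -> C) (tnth v).
rewrite -[LHS]/(ev _) /rho_sigma2.
rewrite !(rmorphD, rmorphB, rmorphN, rmorphM, rmorphXn) ?rmorph1.
by rewrite -![ev 'X_(_)]/(eval_at v _) !eval_at_var.
Qed.
End EvalAt.

(** As for rho, conjugation by g multiplies the numerator of sigma1, a form of
    degree 4, by det g ^+ 6; likewise for sigma2. *)
Lemma rho_sigma1_invariant : SL2_invariant rho_sigma1 1.
Proof.
move=> C g v dg _; rewrite eval_at_rho_conj //; congr (_ / _).
rewrite det_mx2 in dg.
transitivity ((g 0 0 * g 1 1 - g 0 1 * g 1 0) ^+ 6 * eval_at v rho_sigma1).
  by rewrite !eval_at_rho_sigma1 /conj_map /=; ring.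
by rewrite dg expr1n mul1r.
Qed.

Lemma rho_sigma2_invariant : SL2_invariant rho_sigma2 1.
Proof.
move=> C g v dg _; rewrite eval_at_rho_conj //; congr (_ / _).
rewrite det_mx2 in dg.
transitivity ((g 0 0 * g 1 1 - g 0 1 * g 1 0) ^+ 6 * eval_at v rho_sigma2).
  by rewrite !eval_at_rho_sigma2 /conj_map /=; ring.
by rewrite dg expr1n mul1r.
Qed.

Lemma dhomog_eq n (p : {mpoly int[n]}) d e : p \is d.-homog -> d = e -> p \is e.-homog.
Proof. by move=> hp <-. Qed.

Lemma dhomog_nat n k : (k%:R : {mpoly int[n]}) \is 0.-homog.
Proof. by rewrite rpredMn // dhomog1. Qed.

Lemma dhomog_var n (i : 'I_n) : ('X_i : {mpoly int[n]}) \is 1.-homog.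
Proof. by rewrite dhomogX /= mdeg1. Qed.

(** Proves that an explicit sum of monomials is a form of degree 4, each monomial
    being split into variables and constants. *)
Ltac homog4 :=
  repeat first [ apply: dhomogD | rewrite dhomogN ];
  (apply: dhomog_eq;
   [ repeat first [ exact: dhomog_var | exact: dhomog_nat | rewrite dhomogN
                  | apply: dhomogMn | apply: dhomogM ] | by [] ]).

Lemma rho_sigma1_homog : rho_sigma1 \is 4.-homog.
Proof.
rewrite /rho_sigma1.
homog4.
Qed.

Lemma rho_sigma2_homog : rho_sigma2 \is 4.-homog.
Proof.
rewrite /rho_sigma2.
homog4.
Qed.

(** * Invariants and Milnor's normal form *)

Import Num.Theory.

Lemma eval_at_scale (C : comNzRingType) (l : C) (v : 6.-tuple C) N d :
  N \is d.-homog -> eval_at (map_tuple ( *%R l) v) N = l ^+ d * eval_at v N.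
Proof.
move=> hN; rewrite /eval_at /mmap mulr_sumr big_seq [RHS]big_seq.
apply: eq_bigr => m mN; rewrite mulrCA; congr (_ * _).
rewrite -(dhomog_mf hN mN) /mmap1 /= mdegE -prodrXr -big_split /=.
by apply: eq_bigr => i _; rewrite tnth_map exprMn.
Qed.

(** The value of the function N / rho^k at the point v of Rat_2. *)
Definition value (N : {mpoly int[6]}) (k : nat) (v : 6.-tuple algC) : algC :=
  eval_at v N / eval_at v rho ^+ k.

(** Milnor's normal form [X^2 + m1 X Y, m2 X Y + Y^2]: the multipliers at the fixed
    points 0 and infinity are m1 and m2, and the resultant is 1 - m1 m2. *)
Definition milnor (m1 m2 : algC) : 6.-tuple algC := [tuple 1; m1; 0; 0; m2; 1].

(** The matrix with rows (a, b) and (c, d). *)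
Definition mat2 (C : comNzRingType) (a b c d : C) : 'M[C]_2 :=
  \matrix_(i, j) if i == 0 then if j == 0 then a else b else if j == 0 then c else d.

Lemma det_mat2 (C : comNzRingType) (a b c d : C) : \det (mat2 a b c d) = a * d - b * c.
Proof. by rewrite det_mx2 !mxE. Qed.

Lemma conj_mat2 (C : comNzRingType) (al be ga de a0 a1 a2 b0 b1 b2 : C) :
  let s0 c0 c1 c2 := c0 * al ^+ 2 + c1 * al * ga + c2 * ga ^+ 2 in
  let s1 c0 c1 c2 := 2 * c0 * al * be + c1 * (al * de + be * ga)
                     + 2 * c2 * ga * de in
  let s2 c0 c1 c2 := c0 * be ^+ 2 + c1 * be * de + c2 * de ^+ 2 in
  conj_map (mat2 al be ga de) [tuple a0; a1; a2; b0; b1; b2] =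
  [tuple de * s0 a0 a1 a2 - be * s0 b0 b1 b2; de * s1 a0 a1 a2 - be * s1 b0 b1 b2;
     de * s2 a0 a1 a2 - be * s2 b0 b1 b2; - ga * s0 a0 a1 a2 + al * s0 b0 b1 b2;
     - ga * s1 a0 a1 a2 + al * s1 b0 b1 b2; - ga * s2 a0 a1 a2 + al * s2 b0 b1 b2].
Proof. by rewrite /conj_map !mxE. Qed.

Section Invariant.
Variables (N : {mpoly int[6]}) (k : nat).
Hypotheses (hN : N \is (4 * k)%N.-homog) (iN : SL2_invariant N k).

(** A function of degree 0 takes the same value at v and at l v, which are the same
    point of projective space. *)
Lemma value_scale (l : algC) v : l != 0 ->
  value N k (map_tuple ( *%R l) v) = value N k v.
Proof.
move=> l0; rewrite /value (eval_at_scale _ _ hN) (eval_at_scale _ _ rho_homog).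
by rewrite exprMn -exprM invfM mulrACA divff ?mul1r // expf_neq0.
Qed.

Lemma value_conj (g : 'M[algC]_2) v : \det g = 1 -> eval_at v rho != 0 ->
  value N k (conj_map g v) = value N k v.
Proof. by move=> dg v0; apply: iN => //; rewrite unitfE. Qed.

(** A map fixing 0 and infinity is conjugate, by a diagonal matrix, to a Milnor
    form. *)
Lemma value_torus (p q r s m1 m2 : algC) :
  eval_at [tuple p; q; 0; 0; r; s] rho != 0 -> q = m1 * s -> r = m2 * p ->
  value N k [tuple p; q; 0; 0; r; s] = value N k (milnor m1 m2).
Proof.
move=> v0 qE rE.
have /andP[p0 s0] : (p != 0) && (s != 0).
  rewrite -negb_or; apply: contra v0 => /orP[] /eqP e;
    by rewrite eval_at_rho /= qE rE e; apply/eqP; ring.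
(* Conjugation by diag (al, 1/al) multiplies the coefficients of X^2 and Y^2 by al
   and 1/al; this choice of al makes them equal. *)
pose al := sqrtC (s / p).
have al2 : al ^+ 2 = s / p by rewrite sqrtCK.
have al0 : al != 0 by rewrite sqrtC_eq0 mulf_neq0 ?invr_eq0.
have pal : p * al = s / al.
  by apply: (mulIf al0); rewrite -mulrA -expr2 al2 divfK // mulrC divfK.
rewrite -(@value_conj (mat2 al 0 0 al^-1)) //; last first.
  by rewrite det_mat2 mulfV // mul0r subr0.
rewrite -(@value_scale (p * al) (milnor _ _)) ?mulf_neq0 //; congr value.
rewrite conj_mat2 /= qE rE; apply/val_inj => /=; congr [:: _; _; _; _; _; _].
- by field.
- by rewrite pal; field.
- by field.
- by field.
- by field.
- by rewrite mulr1 pal; field.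
Qed.

(** Exchanging the fixed points 0 and infinity. *)
Lemma value_milnorC m1 m2 : 1 - m1 * m2 != 0 ->
  value N k (milnor m1 m2) = value N k (milnor m2 m1).
Proof.
move=> m0; have v0 : eval_at (milnor m1 m2) rho != 0.
  by apply: contraNneq m0 => <-; apply/eqP; rewrite eval_at_rho /=; ring.
have dg : \det (mat2 0 1 (-1) 0 : 'M[algC]_2) = 1 by rewrite det_mat2; ring.
have E : conj_map (mat2 0 1 (-1) 0) (milnor m1 m2) = [tuple -1; m2; 0; 0; - m1; 1].
  by rewrite conj_mat2; apply/val_inj; congr [:: _; _; _; _; _; _]; ring.
rewrite -(value_conj dg v0) E; apply: value_torus; last 2 first.
- by rewrite mulr1.
- by rewrite mulrN1.
by rewrite -E eval_at_rho_conj.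
Qed.

(** Replacing the fixed point infinity by the third one, (1 - m1) / (1 - m2), whose
    multiplier is (2 - m1 - m2) / (1 - m1 m2). *)
Lemma value_milnor_third m1 m2 : 1 - m1 * m2 != 0 -> m1 != 1 ->
  value N k (milnor m1 m2) =
  value N k (milnor m1 ((2 - m1 - m2) / (1 - m1 * m2))).
Proof.
move=> m0 m1n; have v0 : eval_at (milnor m1 m2) rho != 0.
  by apply: contraNneq m0 => <-; apply/eqP; rewrite eval_at_rho /=; ring.
have m1n' : 1 - m1 != 0 by rewrite subr_eq0 eq_sym.
(* mat2 1 0 ga 1 fixes 0 and sends infinity to 1 / ga, the third fixed point. *)
pose ga := (1 - m2) / (1 - m1).
have dg : \det (mat2 1 0 ga 1 : 'M[algC]_2) = 1 by rewrite det_mat2; ring.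
have E : conj_map (mat2 1 0 ga 1) (milnor m1 m2)
    = [tuple 1 + m1 * ga; m1; 0; 0; m2 + (2 - m1) * ga; 1].
  rewrite conj_mat2; apply/val_inj; rewrite /ga; congr [:: _; _; _; _; _; _];
    by field.
rewrite -(value_conj dg v0) E; apply: value_torus; last 2 first.
- by rewrite mulr1.
- by rewrite /ga; field; rewrite m1n' m0.
by rewrite -E eval_at_rho_conj.
Qed.
End Invariant.

(** A map with two distinct finite fixed points z1 and z2 is conjugate to a Milnor
    form; fix_eq is the dehomogenized form X F_b - Y F_a. *)
Lemma value_fixed_points (v : 6.-tuple algC) (z1 z2 : algC) :
  let fix_eq z := v`_3 * z ^+ 3 + (v`_4 - v`_0) * z ^+ 2 + (v`_5 - v`_1) * z - v`_2 in
  eval_at v rho != 0 -> z1 != z2 -> fix_eq z1 = 0 -> fix_eq z2 = 0 ->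
  exists m1 m2, 1 - m1 * m2 != 0 /\
    forall N k, N \is (4 * k)%N.-homog -> SL2_invariant N k ->
      value N k v = value N k (milnor m1 m2).
Proof.
move=> fix_eq v0 z12 f1 f2; have t0 : z2 - z1 != 0 by rewrite subr_eq0 eq_sym.
(* g sends 0 to z1 and infinity to z2. *)
pose t := (z2 - z1)^-1; pose g := mat2 (z2 * t) z1 t 1.
have dg : \det g = 1 by rewrite det_mat2 /t; field.
pose w := conj_map g v.
have w0 : eval_at w rho != 0 by rewrite eval_at_rho_conj.
have wE : w = [tuple w`_0; w`_1; 0; 0; w`_4; w`_5].
  apply/val_inj; rewrite /w /conj_map !mxE /=; congr [:: _; _; _; _; _; _].
    by transitivity (- fix_eq z1); [rewrite /fix_eq; ring | rewrite f1 oppr0].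
  by transitivity (t ^+ 3 * fix_eq z2); [rewrite /fix_eq; ring | rewrite f2 mulr0].
move: w0; rewrite wE; set p := w`_0; set q := w`_1; set r := w`_4; set s := w`_5.
move=> w0.
have /andP[p0 s0] : (p != 0) && (s != 0).
  rewrite -negb_or; apply: contra w0 => /orP[] /eqP e;
    by rewrite eval_at_rho /= e; apply/eqP; ring.
exists (q / s), (r / p); split.
  apply: contraNneq w0 => e; apply/eqP; rewrite eval_at_rho /=.
  transitivity (p ^+ 2 * s ^+ 2 * (1 - q / s * (r / p))); last by rewrite e mulr0.
  by field; rewrite p0 s0.
move=> N k hN iN; rewrite -(value_conj iN dg v0) -/w wE.
by apply: value_torus => //; rewrite divfK.
Qed.

(** Evaluation of a polynomial in two variables at (s1, s2). *)
Definition eval2 (C : comNzRingType) (s1 s2 : C) : {rmorphism {mpoly int[2]} -> C} :=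
  mmap (intr : int -> C) (fun i : 'I_2 => if i == 0 then s1 else s2).

Lemma eval2_X0 (C : comNzRingType) (s1 s2 : C) : eval2 s1 s2 'X_0 = s1.
Proof. by rewrite /eval2 /= mmapX mmap1U. Qed.

Lemma eval2_X1 (C : comNzRingType) (s1 s2 : C) : eval2 s1 s2 'X_1 = s2.
Proof. by rewrite /eval2 /= mmapX mmap1U. Qed.

Lemma mpoly2_eq0_algC (P : {mpoly int[2]}) :
  (forall s1 s2 : algC, eval2 s1 s2 P = 0) -> P = 0.
Proof.
move=> P0; apply: mpoly_eq0_algC => v; rewrite -[RHS](P0 (v 0) (v 1)) /eval2 /=.
congr mmap; by apply/funext => i; case: (ord2P i) => ->.
Qed.

Lemma cubic_roots (e1 e2 e3 : algC) : exists z1 z2 z3,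
  [/\ z1 + z2 + z3 = e1, z1 * z2 + z1 * z3 + z2 * z3 = e2 & z1 * z2 * z3 = e3].
Proof.
have [z1 z1E] := @solve_monicpoly algC 3 (nth 0 [:: e3; - e2; e1]) isT.
(* z2 is a root of the quotient of the cubic by T - z1. *)
have [z2 z2E] := @solve_monicpoly algC 2
  (nth 0 [:: - (e2 - z1 * (e1 - z1)); e1 - z1]) isT.
move: z1E z2E; rewrite !big_ord_recl !big_ord0 /= => z1E z2E.
have e2E : e2 = z1 * z2 + z1 * (e1 - z1 - z2) + z2 * (e1 - z1 - z2).
  apply/eqP; rewrite -subr_eq0; apply/eqP.
  rewrite -[RHS](subrr (z2 ^+ 2)) [in X in _ = _ - X]z2E; ring.
exists z1, z2, (e1 - z1 - z2); split=> //; first by ring.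
apply/eqP; rewrite -subr_eq0; apply/eqP.
by rewrite -[RHS](subrr (z1 ^+ 3)) [in X in _ = _ - X]z1E e2E; ring.
Qed.

(** Where this polynomial does not vanish, infinity is not fixed and the three
    fixed points are not all equal: for a cubic b0 (T - z)^3 the second factor is
    zero. *)
Definition fixed_point_condition : {mpoly int[6]} :=
  'X_(inord 3) * (('X_(inord 4) - 'X_(inord 0)) ^+ 2
    - 3 * 'X_(inord 3) * ('X_(inord 5) - 'X_(inord 1))).

Lemma eval_fixed_point_condition (C : comNzRingType) (v : 6.-tuple C) :
  eval_at v fixed_point_condition =
    v`_3 * ((v`_4 - v`_0) ^+ 2 - 3 * v`_3 * (v`_5 - v`_1)).
Proof.
pose ev : {rmorphism {mpoly int[6]} -> C} := mmap (intr : int -> C) (tnth v).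
rewrite -[LHS]/(ev _) /fixed_point_condition.
rewrite !(rmorphD, rmorphB, rmorphN, rmorphM, rmorphXn) ?rmorph1.
by rewrite -![ev 'X_(_)]/(eval_at v _) !eval_at_var.
Qed.

Lemma milnor_form (v : 6.-tuple algC) :
  eval_at v rho != 0 -> eval_at v fixed_point_condition != 0 ->
  exists m1 m2, 1 - m1 * m2 != 0 /\
    forall N k, N \is (4 * k)%N.-homog -> SL2_invariant N k ->
      value N k v = value N k (milnor m1 m2).
Proof.
rewrite eval_fixed_point_condition mulf_eq0 negb_or => v0 /andP[b0 W].
have [z1 [z2 [z3 [e1 e2 e3]]]] := cubic_roots (- (v`_4 - v`_0) / v`_3)
  ((v`_5 - v`_1) / v`_3) (v`_2 / v`_3).
have E1 : v`_4 - v`_0 = - (z1 + z2 + z3) * v`_3 by rewrite e1; field.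
have E2 : v`_5 - v`_1 = (z1 * z2 + z1 * z3 + z2 * z3) * v`_3 by rewrite e2; field.
have E3 : v`_2 = z1 * z2 * z3 * v`_3 by rewrite e3; field.
have [z12|z12] := eqVneq z1 z2; last first.
  by apply: (value_fixed_points v0 z12); rewrite E1 E2 E3; ring.
have z13 : z1 != z3.
  by apply: contraNneq W => z13; rewrite E1 E2 -z12 -z13; apply/eqP; ring.
by apply: (value_fixed_points v0 z13); rewrite E1 E2 E3; ring.
Qed.

(** * Polynomial functions of the multipliers *)

Section Span.
Implicit Types h : algC -> algC -> algC -> algC.

(** The relation sigma3 = sigma1 - 2 between the multipliers at the fixed points. *)
Definition on_surface (m1 m2 m3 : algC) := m1 * m2 * m3 = m1 + m2 + m3 - 2.

(** P evaluated at the first two elementary symmetric functions of m1, m2, m3. *)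
Definition eval_sym (P : {mpoly int[2]}) (m1 m2 m3 : algC) : algC :=
  eval2 (m1 + m2 + m3) (m1 * m2 + m1 * m3 + m2 * m3) P.

(** The functions of the multipliers that are combinations of the six monomials
    m1^i m2^j, with i <= 2 and j <= 1, with coefficients in Z[sigma1, sigma2]. They
    turn out to include every polynomial function with integer coefficients. *)
Definition in_span h := exists c0 c1 c2 d0 d1 d2 : {mpoly int[2]},
  forall m1 m2 m3, on_surface m1 m2 m3 ->
    let e P := eval_sym P m1 m2 m3 in
    h m1 m2 m3 = e c0 + e c1 * m1 + e c2 * m1 ^+ 2
                 + (e d0 + e d1 * m1 + e d2 * m1 ^+ 2) * m2.

Lemma in_span_ext h h' :
  (forall m1 m2 m3, on_surface m1 m2 m3 -> h m1 m2 m3 = h' m1 m2 m3) ->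
  in_span h -> in_span h'.
Proof.
move=> hh' [c0 [c1 [c2 [d0 [d1 [d2 hE]]]]]]; exists c0, c1, c2, d0, d1, d2.
by move=> m1 m2 m3 S; rewrite -hh' //; apply: hE.
Qed.

Lemma in_span_sym P : in_span (eval_sym P).
Proof.
exists P, 0, 0, 0, 0, 0 => m1 m2 m3 _ /=; rewrite {2 3 4 5 6}/eval_sym !rmorph0; ring.
Qed.

Lemma in_spanD h h' : in_span h -> in_span h' ->
  in_span (fun m1 m2 m3 => h m1 m2 m3 + h' m1 m2 m3).
Proof.
move=> [c0 [c1 [c2 [d0 [d1 [d2 hE]]]]]] [c0' [c1' [c2' [d0' [d1' [d2' hE']]]]]].
exists (c0 + c0'), (c1 + c1'), (c2 + c2'), (d0 + d0'), (d1 + d1'), (d2 + d2').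
move=> m1 m2 m3 S /=; rewrite hE // hE' // /eval_sym !rmorphD /=; ring.
Qed.

Lemma in_spanZ P h : in_span h ->
  in_span (fun m1 m2 m3 => eval_sym P m1 m2 m3 * h m1 m2 m3).
Proof.
move=> [c0 [c1 [c2 [d0 [d1 [d2 hE]]]]]].
exists (P * c0), (P * c1), (P * c2), (P * d0), (P * d1), (P * d2).
move=> m1 m2 m3 S /=; rewrite hE // /eval_sym !rmorphM /=; ring.
Qed.

(** On the surface, m1 is a root of T^3 - s1 T^2 + s2 T - (s1 - 2), so m1^3 reduces. *)
Lemma in_spanM1 h : in_span h -> in_span (fun m1 m2 m3 => m1 * h m1 m2 m3).
Proof.
move=> [c0 [c1 [c2 [d0 [d1 [d2 hE]]]]]].
pose s1 : {mpoly int[2]} := 'X_0; pose s2 : {mpoly int[2]} := 'X_1.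
exists ((s1 - 2) * c2), (c0 - s2 * c2), (c1 + s1 * c2),
  ((s1 - 2) * d2), (d0 - s2 * d2), (d1 + s1 * d2).
move=> m1 m2 m3 S /=; rewrite hE //= /eval_sym.
rewrite !(rmorphD, rmorphB, rmorphM, rmorphN) rmorph1 eval2_X0 eval2_X1.
have -> : m1 + m2 + m3 - (1 + 1) = m1 * m2 * m3 by rewrite S; ring.
ring.
Qed.

(** m2 is a root of T^2 - (s1 - m1) T + (s2 - m1 (s1 - m1)), so m2^2 reduces. *)
Lemma in_spanM2 h : in_span h -> in_span (fun m1 m2 m3 => m2 * h m1 m2 m3).
Proof.
move=> [c0 [c1 [c2 [d0 [d1 [d2 hE]]]]]].
pose s1 : {mpoly int[2]} := 'X_0; pose s2 : {mpoly int[2]} := 'X_1.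
pose q (d0 d1 d2 : {mpoly int[2]}) (m1 m2 m3 : algC) :=
  eval_sym d0 m1 m2 m3 + eval_sym d1 m1 m2 m3 * m1 + eval_sym d2 m1 m2 m3 * m1 ^+ 2.
have q_span e0 e1 e2 : in_span (q e0 e1 e2).
  by exists e0, e1, e2, 0, 0, 0 => m1 m2 m3 _; rewrite /= /q /eval_sym !rmorph0; ring.
have qm2 e0 e1 e2 : in_span (fun m1 m2 m3 => q e0 e1 e2 m1 m2 m3 * m2).
  by exists 0, 0, 0, e0, e1, e2 => m1 m2 m3 _; rewrite /= /q /eval_sym !rmorph0; ring.
have m1q2 := in_spanM1 (qm2 d0 d1 d2).
have m1q := in_spanM1 (q_span d0 d1 d2).
(* For h = A + B m2, with A and B polynomials in m1,
   m2 h = A m2 + B ((s1 - m1) m2 - s2 + s1 m1 - m1^2). *)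
have H := in_spanD (qm2 c0 c1 c2) (in_spanD (in_spanD (in_spanZ s1 (qm2 d0 d1 d2))
  (in_spanZ (-1) m1q2)) (in_spanD (in_spanZ (- s2) (q_span d0 d1 d2))
  (in_spanD (in_spanZ s1 m1q) (in_spanZ (-1) (in_spanM1 m1q))))).
apply: in_span_ext H => m1 m2 m3 S; rewrite hE // /q /s1 /s2 /eval_sym.
rewrite !rmorphN rmorph1 eval2_X0 eval2_X1; ring.
Qed.

Lemma in_spanM h h' : in_span h -> in_span h' ->
  in_span (fun m1 m2 m3 => h m1 m2 m3 * h' m1 m2 m3).
Proof.
move=> [c0 [c1 [c2 [d0 [d1 [d2 hE]]]]]] sh'.
have sm := in_spanM1 sh'; have smm := in_spanM1 sm.
have quad e0 e1 e2 := in_spanD (in_spanZ e0 sh')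
  (in_spanD (in_spanZ e1 sm) (in_spanZ e2 smm)).
apply: in_span_ext (in_spanD (quad c0 c1 c2) (in_spanM2 (quad d0 d1 d2))).
by move=> m1 m2 m3 S; rewrite hE //=; ring.
Qed.

Lemma in_spanX h n : in_span h -> in_span (fun m1 m2 m3 => h m1 m2 m3 ^+ n).
Proof.
move=> sh; elim: n => [|n IHn].
  by apply: in_span_ext (in_span_sym 1) => m1 m2 m3 _; rewrite /eval_sym rmorph1.
by apply: in_span_ext (in_spanM sh IHn) => m1 m2 m3 _; rewrite exprS.
Qed.

Lemma in_span_int (c : int) : in_span (fun _ _ _ => c%:~R).
Proof. by apply: in_span_ext (in_span_sym c%:~R) => *; rewrite /eval_sym rmorph_int. Qed.

Lemma in_span_m1 : in_span (fun m1 _ _ => m1).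
Proof.
by apply: in_span_ext (in_spanM1 (in_span_int 1)) => *; rewrite mulr1.
Qed.

Lemma in_span_m2 : in_span (fun _ m2 _ => m2).
Proof.
by apply: in_span_ext (in_spanM2 (in_span_int 1)) => *; rewrite mulr1.
Qed.

Lemma in_span_m3 : in_span (fun _ _ m3 => m3).
Proof.
have N1 := in_span_int (-1).
apply: in_span_ext (in_spanD (in_span_sym 'X_0) (in_spanD (in_spanM N1 in_span_m1)
  (in_spanM N1 in_span_m2))).
by move=> m1 m2 m3 _; rewrite /eval_sym eval2_X0; ring.
Qed.

Lemma in_span_milnor N : in_span (fun m1 m2 _ => eval_at (milnor m1 m2) N).
Proof.
elim/mpoly_ring_ind: N => [c|i|p q sp sq|p q sp sq].
- apply: in_span_ext (in_span_int c) => m1 m2 _ _; exact/esym/rmorph_int.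
- have E m1 m2 : eval_at (milnor m1 m2) 'X_i = (milnor m1 m2)`_i.
    by rewrite /eval_at mmapX mmap1U (tnth_nth 0).
  have [s0 s1] := (in_span_int 0, in_span_int 1).
  case: i E => -[|[|[|[|[|[|//]]]]]] /= lt6 E.
  + by apply: in_span_ext s1 => *; rewrite E.
  + by apply: in_span_ext in_span_m1 => *; rewrite E.
  + by apply: in_span_ext s0 => *; rewrite E.
  + by apply: in_span_ext s0 => *; rewrite E.
  + by apply: in_span_ext in_span_m2 => *; rewrite E.
  + by apply: in_span_ext s1 => *; rewrite E.
- by apply: in_span_ext (in_spanD sp sq) => *; rewrite eval_atD.
- by apply: in_span_ext (in_spanM sp sq) => *; rewrite eval_atM.
Qed.
End Span.

(** * Invariants as functions of the multipliers *)

(** 2 s1 - s2 - 3, whose zero locus in the plane is the line of the maps with a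
    multiple fixed point. *)
Definition double_line : {mpoly int[2]} := 2 * 'X_0 - 'X_1 - 3.

Lemma eval2_double_line (C : comNzRingType) (s1 s2 : C) :
  eval2 s1 s2 double_line = 2 * s1 - s2 - 3.
Proof.
by rewrite /double_line !(rmorphB, rmorphM) ?rmorph1 ?rmorph_nat eval2_X0 eval2_X1.
Qed.

(** The discriminant of T^3 - s1 T^2 + s2 T - (s1 - 2), whose roots are the
    multipliers at the fixed points. *)
Definition multiplier_disc : {mpoly int[2]} :=
  let e1 := 'X_0 in let e2 := 'X_1 in let e3 := 'X_0 - 2 in
  e1 ^+ 2 * e2 ^+ 2 - 4 * e2 ^+ 3 - 4 * e1 ^+ 3 * e3
  + 18 * e1 * e2 * e3 - 27 * e3 ^+ 2.

Lemma eval2_multiplier_disc (C : comNzRingType) (s1 s2 : C) :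
  eval2 s1 s2 multiplier_disc =
  s1 ^+ 2 * s2 ^+ 2 - 4 * s2 ^+ 3 - 4 * s1 ^+ 3 * (s1 - 2)
  + 18 * s1 * s2 * (s1 - 2) - 27 * (s1 - 2) ^+ 2.
Proof.
rewrite /multiplier_disc !(rmorphB, rmorphD, rmorphM, rmorphXn).
by rewrite ?rmorph1 ?rmorph_nat eval2_X0 eval2_X1.
Qed.

Lemma double_line_neq0 : double_line != 0.
Proof.
apply/eqP => /(congr1 (eval2 0 0 : _ -> int)).
by rewrite rmorph0 eval2_double_line.
Qed.

Lemma multiplier_disc_neq0 : multiplier_disc != 0.
Proof.
apply/eqP => /(congr1 (eval2 0 0 : _ -> int)).
by rewrite rmorph0 eval2_multiplier_disc.
Qed.

(** The product of the resultants of the three Milnor forms of a map. *)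
Lemma sym_double_line m1 m2 m3 : on_surface m1 m2 m3 ->
  eval_sym double_line m1 m2 m3 = (1 - m1 * m2) * (1 - m1 * m3) * (1 - m2 * m3).
Proof.
move=> S; rewrite /eval_sym eval2_double_line.
transitivity (1 - (m1 * m2 + m1 * m3 + m2 * m3) + (m1 + m2 + m3) * (m1 * m2 * m3)
  - (m1 * m2 * m3) ^+ 2); last by ring.
by rewrite S; ring.
Qed.

(** Minus the value at 1 of the polynomial with roots m1, m2, m3. *)
Lemma sym_double_line1 m1 m2 m3 : on_surface m1 m2 m3 ->
  eval_sym double_line m1 m2 m3 = - ((1 - m1) * (1 - m2) * (1 - m3)).
Proof.
move=> S; rewrite /eval_sym eval2_double_line.
transitivity (- (1 - (m1 + m2 + m3) + (m1 * m2 + m1 * m3 + m2 * m3) - m1 * m2 * m3));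
  last by ring.
by rewrite S; ring.
Qed.

Lemma quadratic_const (c0 c1 c2 e x y z : algC) :
  x != y -> x != z -> y != z ->
  c0 + c1 * x + c2 * x ^+ 2 = e -> c0 + c1 * y + c2 * y ^+ 2 = e ->
  c0 + c1 * z + c2 * z ^+ 2 = e -> [/\ c0 = e, c1 = 0 & c2 = 0].
Proof.
rewrite -[x == y]subr_eq0 -[x == z]subr_eq0 -[y == z]subr_eq0 => xy xz yz ex ey ez.
have c2E : c2 = 0.
  apply: (mulIf (mulf_neq0 (mulf_neq0 xy xz) yz)).
  transitivity ((c0 + c1 * x + c2 * x ^+ 2) * (y - z)
    + (c0 + c1 * y + c2 * y ^+ 2) * (z - x)
    + (c0 + c1 * z + c2 * z ^+ 2) * (x - y)); first by ring.
  by rewrite ex ey ez; ring.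
have c1E : c1 = 0.
  apply: (mulIf xy); rewrite mul0r.
  transitivity ((c0 + c1 * x + c2 * x ^+ 2) - (c0 + c1 * y + c2 * y ^+ 2)).
    by rewrite c2E; ring.
  by rewrite ex ey subrr.
by split=> //; rewrite -ex c1E c2E; ring.
Qed.

(** Once multiplied by a power of double_line, an invariant function of the Milnor
    form is an integral polynomial in sigma1 and sigma2. It is a combination of the
    m1^i m2^j, and it is unchanged when the multipliers are permuted; where they are
    distinct this forces all the coefficients but that of 1 to vanish. *)
Lemma invariant_on_milnor N k :
  N \is (4 * k)%N.-homog -> SL2_invariant N k ->
  exists P, forall m1 m2 m3, on_surface m1 m2 m3 -> 1 - m1 * m2 != 0 ->
    value N k (milnor m1 m2) * eval_sym double_line m1 m2 m3 ^+ k = eval_sym P m1 m2 m3.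
Proof.
move=> hN iN.
pose h m1 m2 m3 := eval_at (milnor m1 m2) N * ((1 - m1 * m3) * (1 - m2 * m3)) ^+ k.
have one_sub u v : in_span u -> in_span v ->
    in_span (fun m1 m2 m3 => 1 - u m1 m2 m3 * v m1 m2 m3).
  move=> su sv; apply: in_span_ext (in_spanD (in_span_int 1)
    (in_spanM (in_span_int (-1)) (in_spanM su sv))).
  by move=> *; rewrite mulN1r.
have [c0 [c1 [c2 [d0 [d1 [d2 hE]]]]]] : in_span h.
  apply: in_spanM (in_span_milnor N) _; apply: in_spanX.
  by apply: in_spanM; apply: one_sub; [exact: in_span_m1 | exact: in_span_m3
    | exact: in_span_m2 | exact: in_span_m3].
(* h clears the denominator (1 - m1 m2)^k of the invariant. *)
have hV m1 m2 m3 : on_surface m1 m2 m3 -> 1 - m1 * m2 != 0 ->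
    value N k (milnor m1 m2) * eval_sym double_line m1 m2 m3 ^+ k = h m1 m2 m3.
  move=> S n12; rewrite sym_double_line // -mulrA exprMn mulrA /h; congr (_ * _).
  rewrite /value eval_at_rho /=.
  set r := (X in _ / X ^+ k); have -> : r = 1 - m1 * m2 by rewrite /r; ring.
  by rewrite divfK // expf_neq0.
(* Every point (s1, s2) comes from a triple on the surface, so a polynomial in
   sigma1 and sigma2 is zero when it vanishes at the triples of distinct
   multipliers outside the double line. *)
have zero P : (forall m1 m2 m3, on_surface m1 m2 m3 ->
    m1 != m2 -> m1 != m3 -> m2 != m3 -> eval_sym double_line m1 m2 m3 != 0 ->
    eval_sym P m1 m2 m3 = 0) -> P = 0.
  move=> P0; apply/eqP.
  have: P * (double_line * multiplier_disc) == 0.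
    apply/eqP; apply: mpoly2_eq0_algC => s1 s2.
    have [m1 [m2 [m3 [e1 e2 e3]]]] := cubic_roots s1 s2 (s1 - 2).
    have S : on_surface m1 m2 m3 by rewrite /on_surface e3 e1.
    rewrite !rmorphM; apply/eqP; rewrite !mulf_eq0.
    apply: contraT; rewrite !negb_or => /and3P[/negP Pn0 Ln0 Dn0]; case: Pn0.
    have: (m1 - m2) * (m1 - m3) * (m2 - m3) != 0.
      apply: contraNneq Dn0 => D0; apply/eqP; rewrite eval2_multiplier_disc -e3 -e2 -e1.
      transitivity (((m1 - m2) * (m1 - m3) * (m2 - m3)) ^+ 2); first by ring.
      by rewrite D0 expr0n.
    rewrite !mulf_eq0 !subr_eq0 !negb_or => /andP[/andP[n12 n13] n23].
    by have := P0 _ _ _ S n12 n13 n23; rewrite /eval_sym e1 e2 => ->.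
  by rewrite !mulf_eq0 (negPf double_line_neq0) (negPf multiplier_disc_neq0) !orbF.
have swap12 m1 m2 m3 : on_surface m1 m2 m3 -> on_surface m2 m1 m3.
  by rewrite /on_surface [m2 * m1]mulrC [m2 + m1]addrC.
have swap23 m1 m2 m3 : on_surface m1 m2 m3 -> on_surface m1 m3 m2.
  by rewrite /on_surface mulrAC [m1 + m3 + m2]addrAC.
have coef12 P m1 m2 m3 : eval_sym P m2 m1 m3 = eval_sym P m1 m2 m3.
  by rewrite /eval_sym; congr (eval2 _ _ P); ring.
have coef23 P m1 m2 m3 : eval_sym P m1 m3 m2 = eval_sym P m1 m2 m3.
  by rewrite /eval_sym; congr (eval2 _ _ P); ring.
have sym12 m1 m2 m3 : on_surface m1 m2 m3 -> eval_sym double_line m1 m2 m3 != 0 ->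
    h m2 m1 m3 = h m1 m2 m3.
  move=> S L0; have := L0; rewrite sym_double_line // !mulf_eq0 !negb_or.
  move=> /andP[/andP[n12 _] _]; rewrite -!hV //; last 2 first.
  - exact: swap12.
  - by rewrite mulrC.
  by rewrite -(value_milnorC hN iN n12) coef12.
have sym23 m1 m2 m3 : on_surface m1 m2 m3 -> eval_sym double_line m1 m2 m3 != 0 ->
    h m1 m3 m2 = h m1 m2 m3.
  move=> S L0; have := L0; rewrite sym_double_line // !mulf_eq0 !negb_or.
  move=> /andP[/andP[n12 n13] _]; rewrite -!hV //; last exact: swap23.
  have m1n : m1 != 1.
    apply: contraNneq L0 => m1E; apply/eqP; rewrite sym_double_line1 // m1E; ring.
  rewrite (value_milnor_third hN iN n12 m1n) coef23; congr (value _ _ (milnor _ _) * _).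
  apply: (mulIf n12); rewrite divfK //; apply/eqP; rewrite -subr_eq0; apply/eqP.
  transitivity (m1 + m2 + m3 - 2 - m1 * m2 * m3); first by ring.
  by rewrite S subrr.
(* Exchanging the last two arguments of h kills the part of degree 1 in m2; what is
   left is a quadratic polynomial with the same value at m1, m2 and m3. *)
have key m1 m2 m3 : on_surface m1 m2 m3 ->
    m1 != m2 -> m1 != m3 -> m2 != m3 -> eval_sym double_line m1 m2 m3 != 0 ->
    let e P := eval_sym P m1 m2 m3 in
    [/\ e c1 = 0, e c2 = 0, e d0 = 0, e d1 = 0 & e d2 = 0].
  move=> S n12 n13 n23 L0 e.
  have dvanish x y z : on_surface x y z -> y != z -> eval_sym double_line x y z != 0 ->
      eval_sym d0 x y z + eval_sym d1 x y z * x + eval_sym d2 x y z * x ^+ 2 = 0.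
    move=> Sxyz yz Lxyz; apply: (mulIf (_ : y - z != 0)); first by rewrite subr_eq0.
    have := sym23 _ _ _ Sxyz Lxyz.
    rewrite !hE //=; last exact: swap23.
    rewrite !(coef23 _ x y z) => /eqP; rewrite -subr_eq0 => /eqP E.
    by rewrite mul0r -[RHS]oppr0 -[in RHS]E; ring.
  have S' := swap12 _ _ _ S; have S'' := swap12 _ _ _ (swap23 _ _ _ S).
  have D1 := dvanish _ _ _ S n23 L0.
  have D2 := dvanish _ _ _ S' n13; rewrite !(coef12 _ m1 m2 m3) in D2; have {}D2 := D2 L0.
  have D3 := dvanish _ _ _ S'' n12.
  rewrite !(coef12 _ m1 m3 m2) !(coef23 _ m1 m2 m3) in D3; have {}D3 := D3 L0.
  have [d00 d10 d20] := quadratic_const n12 n13 n23 D1 D2 D3.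
  have L0' : eval_sym double_line m1 m3 m2 != 0 by rewrite coef23.
  have E1 := hE _ _ _ S; have E2 := hE _ _ _ S'; have E3 := hE _ _ _ S''.
  rewrite (sym12 _ _ _ S L0) in E2.
  rewrite (sym12 _ _ _ (swap23 _ _ _ S) L0') (sym23 _ _ _ S L0) in E3.
  rewrite /= !(coef12 _ m1 m2 m3) in E2.
  rewrite /= !(coef12 _ m1 m3 m2) !(coef23 _ m1 m2 m3) in E3; rewrite /= in E1.
  rewrite d00 d10 d20 !mul0r !addr0 ?mul0r ?addr0 in E1 E2 E3.
  by have [_ c10 c20] := quadratic_const n12 n13 n23 (esym E1) (esym E2) (esym E3).
have [c10 c20 d00 d10 d20] : [/\ c1 = 0, c2 = 0, d0 = 0, d1 = 0 & d2 = 0].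
  by split; apply: zero => m1 m2 m3 S n12 n13 n23 L0;
    case: (key _ _ _ S n12 n13 n23 L0).
exists c0 => m1 m2 m3 S n12; rewrite hV // hE //= c10 c20 d00 d10 d20.
by rewrite {2 3 4 5 6}/eval_sym !rmorph0; ring.
Qed.

(** * The ring of invariants *)

Lemma value_sigma_milnor m1 m2 m3 : on_surface m1 m2 m3 -> 1 - m1 * m2 != 0 ->
  value rho_sigma1 1 (milnor m1 m2) = m1 + m2 + m3 /\
  value rho_sigma2 1 (milnor m1 m2) = m1 * m2 + m1 * m3 + m2 * m3.
Proof.
move=> S n12; have -> : m3 = (2 - m1 - m2) / (1 - m1 * m2).
  apply: (mulIf n12); rewrite divfK //; apply/eqP; rewrite -subr_eq0; apply/eqP.
  transitivity (m1 + m2 + m3 - 2 - m1 * m2 * m3); first by ring.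
  by rewrite S subrr.
rewrite /value expr1 eval_at_rho eval_at_rho_sigma1 eval_at_rho_sigma2 /=.
set r := (X in _ / X = _ /\ _); have -> : r = 1 - m1 * m2 by rewrite /r; ring.
by split; field.
Qed.

(** Evaluation of a polynomial at (sigma1 v, sigma2 v). *)
Definition eval_sigma (v : 6.-tuple algC) : {rmorphism {mpoly int[2]} -> algC} :=
  eval2 (value rho_sigma1 1 v) (value rho_sigma2 1 v).

(** The identity of [invariant_on_milnor] at a general point, which is conjugate to a
    Milnor form. *)
Lemma invariant_generic N k :
  N \is (4 * k)%N.-homog -> SL2_invariant N k ->
  exists P, forall v, eval_at v rho != 0 -> eval_at v fixed_point_condition != 0 ->
    value N k v * eval_sigma v double_line ^+ k = eval_sigma v P.
Proof.
move=> hN iN; have [P PE] := invariant_on_milnor hN iN; exists P => v v0 v1.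
have [m1 [m2 [n12 vE]]] := milnor_form v0 v1.
pose m3 := (2 - m1 - m2) / (1 - m1 * m2).
have S : on_surface m1 m2 m3 by rewrite /on_surface /m3; field.
have [s1E s2E] := value_sigma_milnor S n12.
have h1 : rho_sigma1 \is (4 * 1)%N.-homog by exact: rho_sigma1_homog.
have h2 : rho_sigma2 \is (4 * 1)%N.-homog by exact: rho_sigma2_homog.
rewrite /eval_sigma vE // (vE _ _ h1 rho_sigma1_invariant) (vE _ _ h2 rho_sigma2_invariant).
by rewrite s1E s2E; exact: PE.
Qed.

Section Value.
Variable v : 6.-tuple algC.
Hypothesis v0 : eval_at v rho != 0.

Lemma valueM N k M l : value (N * M) (k + l) v = value N k v * value M l v.
Proof. by rewrite /value eval_atM exprD invfM mulrACA. Qed.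

Lemma valueD N k M l :
  value (N * rho ^+ l + M * rho ^+ k) (k + l) v = value N k v + value M l v.
Proof.
rewrite /value eval_atD !eval_atM !eval_atX exprD.
by field; rewrite !expf_neq0.
Qed.
End Value.

(** Equality in the function field may be tested at general points. *)
Lemma value_eq_frac N k N' k' :
  (forall v, eval_at v rho != 0 -> eval_at v fixed_point_condition != 0 ->
     value N k v = value N' k' v) ->
  tofrac N / tofrac rho ^+ k = tofrac N' / tofrac rho ^+ k'.
Proof.
move=> NN'; have rz j : tofrac rho ^+ j != 0 by rewrite expf_neq0 // tofrac_eq0 rho_neq0.
apply/eqP; rewrite eqr_div // -!tofracXn -!tofracM tofrac_eq -subr_eq0.
have W0 : fixed_point_condition != 0.
  apply/eqP => /(congr1 (eval_at [tuple 0; 0; 0; 1; 1; 0 : int])).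
  by rewrite eval_fixed_point_condition /eval_at mmap0.
have : (N * rho ^+ k' - N' * rho ^+ k) * (rho * fixed_point_condition) == 0.
  apply/eqP; apply: mpoly_eq0_algC => f.
  have -> : f = tnth [tuple f i | i < 6] by apply/funext => i; rewrite tnth_mktuple.
  set v := [tuple f i | i < 6].
  rewrite -/(eval_at v _) eval_atM (eval_atM v rho) eval_atB.
  rewrite (eval_atM v N) (eval_atM v N') !eval_atX.
  have [->|r0] := eqVneq (eval_at v rho) 0; first by rewrite mul0r mulr0.
  have [->|w0] := eqVneq (eval_at v fixed_point_condition) 0; first by rewrite !mulr0.
  have /eqP := NN' v r0 w0; rewrite /value eqr_div ?expf_neq0 // => /eqP ->.
  by rewrite subrr mul0r.
by rewrite mulf_eq0 (mulf_eq0 rho) (negPf W0) (negPf rho_neq0) !orbF.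
Qed.

Lemma frac_eq_value N k N' k' v :
  tofrac N / tofrac rho ^+ k = tofrac N' / tofrac rho ^+ k' ->
  eval_at v rho != 0 -> value N k v = value N' k' v.
Proof.
have rz j : tofrac rho ^+ j != 0 by rewrite expf_neq0 // tofrac_eq0 rho_neq0.
move=> /eqP; rewrite eqr_div // -!tofracXn -!tofracM tofrac_eq => /eqP e v0.
by apply/eqP; rewrite /value eqr_div ?expf_neq0 // -!eval_atX -!eval_atM e.
Qed.

(** A polynomial in sigma1 and sigma2 is of the form H / rho^d, both in the
    function field and at all points of Rat_2. *)
Lemma sigma_frac P : exists H d,
  eval2 sigma1 sigma2 P = tofrac H / tofrac rho ^+ d /\
  forall v, eval_at v rho != 0 -> eval_sigma v P = value H d v.
Proof.
have r0 : tofrac rho != 0 by rewrite tofrac_eq0 rho_neq0.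
elim/mpoly_ring_ind: P => [c|i|p q [H [d [pE pV]]] [K [e [qE qV]]]
                         |p q [H [d [pE pV]]] [K [e [qE qV]]]].
- exists c%:~R, 0%N; rewrite !expr0 !divr1 !rmorph_int; split=> // v _.
  by rewrite /value expr0 divr1 rmorph_int; apply/esym/rmorph_int.
- have [->|->] := ord2P i.
  + by exists rho_sigma1, 1%N; rewrite eval2_X0; split=> // v _; rewrite /eval_sigma eval2_X0.
  + by exists rho_sigma2, 1%N; rewrite eval2_X1; split=> // v _; rewrite /eval_sigma eval2_X1.
- exists (H * rho ^+ e + K * rho ^+ d), (d + e)%N; split.
    rewrite rmorphD pE qE addf_div ?expf_neq0 //.
    by rewrite (tofracD (H * _)) (tofracM H) (tofracM K) !tofracXn exprD.
  by move=> v v0; rewrite rmorphD pV // qV // valueD.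
- exists (H * K), (d + e)%N; split.
    by rewrite rmorphM pE qE mulf_div (tofracM H) exprD.
  by move=> v v0; rewrite rmorphM pV // qV // valueM.
Qed.

(** sigma1 and sigma2 are algebraically independent, since a point of the plane
    outside the double line is the image of a Milnor form. *)
Lemma sigma_inj P : eval2 sigma1 sigma2 P = 0 -> P = 0.
Proof.
have [H [d [-> PV]]] := sigma_frac P => H0.
have PV0 v : eval_at v rho != 0 -> eval_sigma v P = 0.
  move=> v0; rewrite PV // -[RHS](_ : value 0 0 v = 0).
    by apply: frac_eq_value v0; rewrite H0 tofrac0 mul0r.
  by rewrite /value /eval_at mmap0 mul0r.
suff: P * double_line == 0 by rewrite mulf_eq0 (negPf double_line_neq0) orbF => /eqP.
apply/eqP; apply: mpoly2_eq0_algC => s1 s2; rewrite rmorphM.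
have [m1 [m2 [m3 [e1 e2 e3]]]] := cubic_roots s1 s2 (s1 - 2).
have S : on_surface m1 m2 m3 by rewrite /on_surface e3 e1.
have := sym_double_line S; rewrite /eval_sym e1 e2 => ->.
have [->|n12] := eqVneq (1 - m1 * m2) 0; first by rewrite !mul0r mulr0.
have v0 : eval_at (milnor m1 m2) rho != 0.
  by apply: contraNneq n12 => <-; apply/eqP; rewrite eval_at_rho /=; ring.
have := PV0 _ v0; rewrite /eval_sigma; have [-> ->] := value_sigma_milnor S n12.
by rewrite e1 e2 => ->; rewrite mul0r.
Qed.

(** A polynomial that vanishes on the line is divisible by its equation. *)
Lemma double_line_dvd P :
  (forall s : algC, eval2 s (2 * s - 3) P = 0) -> exists Q, P = double_line * Q.
Proof.
(* r is the restriction to the line. *)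
move=> P0; pose r := eval2 ('X_0 : {mpoly int[2]}) (2 * 'X_0 - 3).
have r0 : r P = 0.
  apply: mpoly2_eq0_algC => s1 s2; rewrite -[RHS](P0 s1).
  have := @rmorph_mpoly_ext _ _ (eval2 s1 s2 \o r) (eval2 s1 (2 * s1 - 3)) _ P.
  apply=> i /=; have [->|->] := ord2P i.
  + by rewrite /r !eval2_X0.
  + by rewrite /r !eval2_X1 rmorphB rmorphM ?rmorph1 ?rmorph_nat eval2_X0.
have [Q QE] : exists Q, P - r P = double_line * Q; last by exists Q; rewrite -QE r0 subr0.
elim/mpoly_ring_ind: P {P0 r0} => [c|i|p q [P pE] [Q qE]|p q [P pE] [Q qE]].
- by exists 0; rewrite rmorph_int subrr mulr0.
- have [->|->] := ord2P i.
  + by exists 0; rewrite /r eval2_X0 subrr mulr0.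
  + by exists (-1); rewrite /r eval2_X1 /double_line; ring.
- by exists (P + Q); rewrite rmorphD opprD addrACA pE qE -mulrDr.
- exists (P * q + r p * Q).
  by rewrite rmorphM [RHS]mulrDr mulrA -pE mulrBl mulrCA -qE mulrBr addrA subrK.
Qed.

(** Every invariant function is an integral polynomial in sigma1 and sigma2. By
    invariant_generic its product with a power of double_line is such a polynomial,
    P; as the invariant is regular along the line, P vanishes there and the factors
    double_line can be removed one at a time. *)
Lemma sigma_surj N k : N \is (4 * k)%N.-homog -> SL2_invariant N k ->
  exists P, tofrac N / tofrac rho ^+ k = eval2 sigma1 sigma2 P.
Proof.
move=> hN iN; set x := _ / _.
suff descent n P : x * eval2 sigma1 sigma2 double_line ^+ n = eval2 sigma1 sigma2 P ->
    exists Q, x = eval2 sigma1 sigma2 Q.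
  have [P PE] := invariant_generic hN iN; apply: (descent k P).
  have [H [d [PF PV]]] := sigma_frac P.
  have [K [e [LF LV]]] := sigma_frac (double_line ^+ k).
  rewrite -rmorphXn LF PF /x mulf_div -tofracM -exprD; apply: value_eq_frac => v v0 v1.
  by rewrite valueM -PV // -LV // rmorphXn PE.
elim: n P => [|n IHn] P; first by rewrite expr0 mulr1; exists P.
move=> xP; have P0 (s : algC) : eval2 s (2 * s - 3) P = 0.
  (* The map [X^2 + c X Y + Y^2, X Y], of resultant 1, has a multiple fixed point at
     infinity; sigma1 = 3 - c^2 takes any value s. *)
  pose v := [tuple 1; sqrtC (3 - s); 1; 0; 1; 0].
  have rho1 : eval_at v rho = 1 by rewrite eval_at_rho /=; ring.
  have c2 := sqrtCK (3 - s).
  have s1E : value rho_sigma1 1 v = s.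
    rewrite /value rho1 eval_at_rho_sigma1 /=.
    by transitivity (3 - sqrtC (3 - s) ^+ 2); [field | rewrite c2; ring].
  have s2E : value rho_sigma2 1 v = 2 * s - 3.
    rewrite /value rho1 eval_at_rho_sigma2 /=.
    by transitivity (3 - 2 * sqrtC (3 - s) ^+ 2); [field | rewrite c2; ring].
  have v0 : eval_at v rho != 0 by rewrite rho1 oner_eq0.
  have [H [d [PF PV]]] := sigma_frac P.
  have [K [e [LF LV]]] := sigma_frac (double_line ^+ n.+1).
  move: xP; rewrite -rmorphXn LF PF /x mulf_div -tofracM -exprD.
  move=> /frac_eq_value /(_ v0); rewrite valueM -PV // -LV // /eval_sigma s1E s2E => <-.
  rewrite rmorphXn eval2_double_line (_ : 2 * s - (2 * s - 3) - 3 = 0) ?expr0n ?mulr0 //.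
  by ring.
have [Q QE] := double_line_dvd P0; apply: (IHn Q).
have L0 : eval2 sigma1 sigma2 double_line != 0.
  by apply/eqP => /sigma_inj/eqP; rewrite (negPf double_line_neq0).
by apply: (mulIf L0); rewrite -mulrA -exprSr xP QE rmorphM mulrC.
Qed.

Lemma sigma1_M2 : sigma1 \in M2_pred.
Proof.
apply/asboolP; exists rho_sigma1, 1%N.
by split; [exact: rho_sigma1_homog | rewrite expr1 | exact: rho_sigma1_invariant].
Qed.

Lemma sigma2_M2 : sigma2 \in M2_pred.
Proof.
apply/asboolP; exists rho_sigma2, 1%N.
by split; [exact: rho_sigma2_homog | rewrite expr1 | exact: rho_sigma2_invariant].
Qed.

Theorem theorem1p2 :
  exists (h1 : sigma1 \in M2_pred) (h2 : sigma2 \in M2_pred),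
    @spec_isomorphism {mpoly int[2]} M2_ring
      (plane_comorphism (M2Ring h1) (M2Ring h2)).
Proof.
exists sigma1_M2, sigma2_M2; set phi := plane_comorphism _ _.
have phiE P : \val (phi P) = eval2 sigma1 sigma2 P.
  have := @rmorph_mpoly_ext _ _ (\val \o phi) (eval2 sigma1 sigma2) _ P.
  by apply=> i; rewrite /= !mmapX !mmap1U; case: ifP.
apply: spec_isomorphism_of_bij => [P Q ePQ|y].
  apply/eqP; rewrite -subr_eq0; apply/eqP/sigma_inj.
  by rewrite rmorphB -!phiE ePQ subrr.
have /asboolP[N [k [hN yE iN]]] := valP y.
have [P PE] := sigma_surj hN iN; exists P; apply: val_inj.
by rewrite phiE -PE -yE.
Qed.
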